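(* Let $Q\in\mathbb R^{n\times n}$ be a symmetric irreducible loopy Laplacian, let $\alpha=\{1,\dots,|\alpha|\}$ with $2\le|\alpha|<n$ be the boundary nodes, let $Q_{\mathrm{red}}=Q[\alpha,\alpha]-Q[\alpha,\alpha)Q(\alpha,\alpha)^{-1}Q(\alpha,\alpha]$ be the Kron-reduced Laplacian and $A_{\mathrm{red}}$ its adjacency matrix. Loop-less case: Suppose $Q$ is loop-less and let $R\in\mathbb R^{n\times n}$, $R_{ij}=(e_i-e_j)^TQ^{\dagger}(e_i-e_j)$. Then the following are equivalent: (1) there is $r>0$ with $R_{ij}=r$ for all distinct $i,j\in\alpha$; (2) there is $a>0$ with $A_{\mathrm{red}}[i,j]=a$ for all distinct $i,j\in\alpha$. If both hold, then $r=\frac{2}{|\alpha|a}$. Strictly loopy case: Suppose $Q$ is strictly loopy, let $\widehat Q$ be its augmented Laplacian with grounded node $n+1$, and let $R\in\mathbb R^{(n+1)\times(n+1)}$, $R_{ij}=(e_i-e_j)^T\widehat Q^{\dagger}(e_i-e_j)$. Then the following are equivalent: (3) there is $r>0$ with $R_{ij}=r$ for all distinct $i,j\in\alpha$, and there is $g>0$ with $R_{i,n+1}=g$ for all $i\in\alpha$; (4) there are $a>0$ and $b\ge0$ with $A_{\mathrm{red}}[i,j]=a$ and $A_{\mathrm{red}}[i,i]=b$ for all distinct $i,j\in\alpha$. If both hold, then $r=\frac{2}{|\alpha|a+b}$ and $g=\frac{a+b}{b(a|\alpha|+b)}$.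
   Context: A loopy Laplacian is built from a symmetric matrix $A\in\mathbb R^{n\times n}$ with nonnegative entries (off-diagonal: edge weights; diagonal $A_{ii}$: self-loop weights): $Q_{ij}=-A_{ij}$ for $i\ne j$, $Q_{ii}=\sum_{j\ne i}A_{ij}+A_{ii}$. It is irreducible if the graph with edges $\{i,j\}$ ($i\ne j$, $A_{ij}>0$) is connected, loop-less if all $A_{ii}=0$, strictly loopy if some $A_{ii}>0$. Conversely a loopy Laplacian $M$ determines its adjacency matrix: off-diagonal entries $-M_{ij}$ and diagonal entries equal to the row sums $\sum_j M_{ij}$. $^{\dagger}$ is the Moore–Penrose pseudoinverse. Block notation: $Q[\alpha,\alpha]$ rows/columns in $\alpha$; $Q(\alpha,\alpha)$ rows/columns in the complement of $\alpha$ (invertible for irreducible $Q$); $Q[\alpha,\alpha)$ rows in $\alpha$, columns in the complement; $Q(\alpha,\alpha]=Q[\alpha,\alpha)^T$. $Q_{\mathrm{red}}$ is again a symmetric loopy Laplacian. The augmented Laplacian is $\widehat Q=\begin{bmatrix}Q&-a\\-a^T&\sum_ia_i\end{bmatrix}\in\mathbb R^{(n+1)\times(n+1)}$ with $a=(A_{11},\dots,A_{nn})^T$. *)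

(* Defs.v *)
From HB Require Import structures.
From mathcomp Require Import all_boot all_order all_algebra.
From mathcomp Require Import boolp classical_sets reals.

Set Implicit Arguments.
Unset Strict Implicit.
Unset Printing Implicit Defensive.

Import Order.TTheory GRing.Theory Num.Theory.
Local Open Scope ring_scope.

Definition loopy_laplacian (R : realType) (n : nat) (A : 'M[R]_n) : 'M[R]_n :=
  \matrix_(i, j)
    if i == j then \sum_(k | k != i) A i k + A i i else - A i j.

Definition adjacency (R : realType) (n : nat) (M : 'M[R]_n) : 'M[R]_n :=
  \matrix_(i, j) if i == j then \sum_k M i k else - M i j.

Lemma loopy_laplacianK (R : realType) (n : nat) :
  cancel (@loopy_laplacian R n) (@adjacency R n).
Proof.
move=> A; apply/matrixP => i j; rewrite mxE.
case: eqVneq => [<-|ij]; last by rewrite mxE (negPf ij) opprK.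
rewrite (bigD1 i) //= mxE eqxx.
under [X in _ + X]eq_bigr => k ki do rewrite mxE eq_sym (negPf ki).
by rewrite sumrN addrAC subrr add0r.
Qed.

Definition symmetric_mx (R : realType) (n : nat) (A : 'M[R]_n) : Prop :=
  A^T = A.

Definition nonneg_mx (R : realType) (n : nat) (A : 'M[R]_n) : Prop :=
  forall i j, 0 <= A i j.

(* Connectedness of the graph of A, self-loops disregarded; [connect] is
   reachability, which is symmetric here only because A is. *)
Definition irreducible (R : realType) (n : nat) (A : 'M[R]_n) : Prop :=
  forall i j : 'I_n, connect [rel k l | (k != l) && (0 < A k l)] i j.

Definition loopless (R : realType) (n : nat) (A : 'M[R]_n) : Prop :=
  forall i, A i i = 0.

Definition strictly_loopy (R : realType) (n : nat) (A : 'M[R]_n) : Prop :=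
  exists i, 0 < A i i.

(* The boundary consists of the first p of the p + q nodes. *)
Definition kron_reduction (R : realType) (p q : nat) (Q : 'M[R]_(p + q)) :
    'M[R]_p :=
  ulsubmx Q - ursubmx Q *m invmx (drsubmx Q) *m dlsubmx Q.

(* The grounded node is the last index, [rshift n ord0]. *)
Definition augmented_laplacian (R : realType) (n : nat) (A : 'M[R]_n) :
    'M[R]_(n + 1) :=
  let a : 'cV[R]_n := \col_i A i i in
  block_mx (loopy_laplacian A) (- a) (- a^T) (\sum_i a i 0)%:M.

Definition is_pinv (R : realType) (m n : nat) (A : 'M[R]_(m, n))
    (X : 'M[R]_(n, m)) : Prop :=
  [/\ A *m X *m A = A, X *m A *m X = X,
      (A *m X)^T = A *m X & (X *m A)^T = X *m A].

(* Moore-Penrose pseudoinverse: the unique solution of the Penrose equations,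
   see [pinvP] and [is_pinv_uniq]. *)
Definition pinv (R : realType) (m n : nat) (A : 'M[R]_(m, n)) :
    'M[R]_(n, m) :=
  xget 0 [set X | is_pinv A X]%classic.

Lemma is_pinv_uniq (R : realType) (m n : nat) (A : 'M[R]_(m, n))
    (X Y : 'M[R]_(n, m)) : is_pinv A X -> is_pinv A Y -> X = Y.
Proof.
move=> [X1 X2 X3 X4] [Y1 Y2 Y3 Y4].
have e1 : A *m X = A *m Y.
  by rewrite -X3 -{1}Y1 -(mulmxA (A *m Y)) trmx_mul X3 Y3 mulmxA X1.
have e2 : X *m A = Y *m A.
  by rewrite -X4 -{1}Y1 -(mulmxA A Y A) mulmxA trmx_mul X4 Y4 -mulmxA (mulmxA A) X1.
by rewrite -X2 e2 -mulmxA e1 mulmxA Y2.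
Qed.

Lemma gram_unitmx (R : realType) (m n : nat) (C : 'M[R]_(m, n)) :
  row_free C -> C *m C^T \in unitmx.
Proof.
move=> fC; rewrite -row_free_unit; apply: inj_row_free => v vCC.
apply: (row_free_inj fC); rewrite mul0mx.
have : (v *m C *m (v *m C)^T) 0 0 = 0.
  by rewrite trmx_mul mulmxA -(mulmxA v) vCC mul0mx mxE.
rewrite mxE; under eq_bigr do rewrite [X in _ * X]mxE -expr2.
move=> /eqP; rewrite psumr_eq0; last by move=> *; exact: sqr_ge0.
move=> /allP vC0; apply/rowP => j; rewrite [RHS]mxE.
by apply/eqP; rewrite -sqrf_eq0; apply: vC0; rewrite mem_index_enum.
Qed.

Lemma pinvP (R : realType) (m n : nat) (A : 'M[R]_(m, n)) :
  is_pinv A (pinv A).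
Proof.
apply: (@xgetPex _ 0 [set X | is_pinv A X]%classic).
have := col_base_full A; have := row_base_free A; have := mulmx_base A.
move: (row_base A) (col_base A); move: (\rank A) => r C B AE fC fB.
have uC : C *m C^T \in unitmx by exact: gram_unitmx.
have uB : B^T *m B \in unitmx.
  have := @gram_unitmx R _ _ B^T; rewrite trmxK; apply.
  by rewrite /row_free mxrank_tr.
pose X := C^T *m invmx (C *m C^T) *m (invmx (B^T *m B) *m B^T).
have AX : A *m X = B *m (invmx (B^T *m B) *m B^T).
  rewrite -AE /X -!mulmxA; congr (_ *m _).
  by rewrite (mulmxA C) mulKVmx.
have XA : X *m A = C^T *m invmx (C *m C^T) *m C.
  rewrite -AE /X -!mulmxA; congr (_ *m (_ *m _)).
  by rewrite (mulmxA B^T) mulKmx.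
exists X; split.
- by rewrite AX -AE -!mulmxA (mulmxA B^T) mulKmx.
- by rewrite XA /X -!mulmxA (mulmxA C) mulKVmx.
- by rewrite AX !trmx_mul trmxK trmx_inv trmx_mul trmxK mulmxA.
- by rewrite XA !trmx_mul trmxK trmx_inv trmx_mul trmxK mulmxA.
Qed.

Definition effective_resistance (R : realType) (n : nat) (L : 'M[R]_n) :
    'M[R]_n :=
  \matrix_(i, j)
    let d : 'cV[R]_n := delta_mx i 0 - delta_mx j 0 in
    (d^T *m pinv L *m d) 0 0.

(* Main.v *)
Require Import Defs.
From HB Require Import structures.
From mathcomp Require Import all_boot all_order all_algebra.
From mathcomp Require Import boolp classical_sets reals.
From mathcomp Require Import ring lra.

Set Implicit Arguments.
Unset Strict Implicit.
Unset Printing Implicit Defensive.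

Import Order.TTheory GRing.Theory Num.Theory.
Local Open Scope ring_scope.

(**
A function x with Q x >= 0 at its minimum is locally constant there, so by
connectedness: the interior block of Q is invertible, the kernel of a loop-less
Q is spanned by 1, and a strictly loopy Q is invertible with an entrywise
positive inverse G.  If Q x = e_i - e_j then R_ij = x_i - x_j, and Q x = (b, 0)
forces Q_red x_alpha = b, so resistances between boundary nodes are read off
K = Q_red.

Loop-less case: on the orthogonal complement of 1, constant resistances r mean
that K is 2/r times the identity, i.e. K = (2/r)(I - J/p) where J is the
all-ones matrix.

Strictly loopy case: x = (G b, 0) solves the augmented system, hence
R_ij = G_ii + G_jj - 2 G_ij and R_(i,n+1) = G_ii.  As G[alpha,alpha] is the
inverse of K, both conditions say that these two matrices are combinations of
I and J; the weight a is positive because the off-diagonal entries of G are.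
*)

(** * Loopy Laplacians and the minimum principle *)

Section Laplacian.
Variables (R : realType) (n : nat) (A : 'M[R]_n).
Let Q := loopy_laplacian A.

(** Grouping a row into a loop term and differences makes the sign of each term visible where [x] is
    minimal. *)
Lemma loopy_laplacian_mulE m (x : 'M[R]_(n, m)) k j :
  (Q *m x) k j = A k k * x k j + \sum_l A k l * (x k j - x l j).
Proof.
rewrite mxE (bigD1 k) //= [X in _ = _ + X](bigD1 k) //= subrr mulr0 add0r.
rewrite mxE eqxx mulrDl mulr_suml.
rewrite [X in X + _]addrC -addrA; congr (_ + _); rewrite -big_split /=.
by apply: eq_bigr => l lk; rewrite mxE eq_sym (negPf lk); ring.
Qed.

Lemma loopy_laplacian_rowsum : Q *m const_mx 1 = \col_k A k k :> 'cV_n.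
Proof.
apply/colP => k; rewrite loopy_laplacian_mulE !mxE mulr1 big1 ?addr0 // => l _.
by rewrite !mxE subrr mulr0.
Qed.

Hypotheses (symA : symmetric_mx A) (nnegA : nonneg_mx A).

Lemma loopy_laplacian_sym : Q^T = Q.
Proof.
apply/matrixP => i j; rewrite !mxE [j == i]eq_sym.
by case: eqVneq => [->//|_]; rewrite -{1}symA mxE.
Qed.

Hypothesis irrA : irreducible A.

(* At a point where [x] attains its minimum [c], all terms of
   (Q x)_k = A_kk c + sum_l A_kl (c - x_l) are nonpositive. *)
Lemma laplacian_min_propagates (x : 'cV[R]_n) (c : R) i :
    (forall k, A k k * c <= 0) -> (forall l, c <= x l 0) ->
    (forall k, x k 0 = c -> 0 <= (Q *m x) k 0) -> x i 0 = c ->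
  forall j, x j 0 = c /\ A j j * c = 0.
Proof.
move=> Ac0 cx Qx xi.
have step k : x k 0 = c ->
    A k k * c = 0 /\ forall l, 0 < A k l -> x l 0 = c.
  move=> xk; have t0 l : A k l * (x k 0 - x l 0) <= 0.
    by rewrite mulr_ge0_le0 ?nnegA // subr_le0 xk.
  have := Qx k xk; rewrite loopy_laplacian_mulE xk => Q0.
  have s0 : \sum_l A k l * (c - x l 0) <= 0.
    by apply: sumr_le0 => l _; rewrite -xk.
  have := Ac0 k => Akc; split; first by lra.
  have /eqP : \sum_l - (A k l * (c - x l 0)) = 0 by rewrite sumrN; lra.
  rewrite psumr_eq0 => [/allP s l Akl|l _]; last by rewrite oppr_ge0 -xk.
  have /= := s l (mem_index_enum l).
  by rewrite oppr_eq0 mulf_eq0 gt_eqF //= subr_eq0 => /eqP.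
(* The value [c] spreads along edges of positive weight, so induction on a path from [i] reaches
   every node. *)
suff H j : x j 0 = c by move=> j; split=> //; exact: (step j (H j)).1.
have /connectP[s] := irrA i j; elim: s i xi => [|l s IH] i xi /=.
  by move=> _ ->.
move=> /andP[/andP[_ Ail] pth] jE; apply: (IH l) => //.
exact: (step i xi).2.
Qed.

Lemma cV_argmin (x : 'cV[R]_n) : n = 0%N \/ exists i, forall l, x i 0 <= x l 0.
Proof.
case: n x => [|m] x; [by left|right].
have [i _ H] :=
  @Order.TotalTheory.arg_minP _ _ _ ord0 predT (fun k => x k 0) isT.
by exists i => l; apply: H.
Qed.

(** Without loops the terms A_kk c vanish, so the minimum principle applies whatever the sign of the
    minimum. *)
Lemma loopless_kernel_constant (x : 'cV[R]_n) :
  loopless A -> Q *m x = 0 -> exists c, x = const_mx c.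
Proof.
move=> lA Qx; have [n0|[i xi]] := cV_argmin x.
  by exists 0; apply/colP => k; have := ltn_ord k; rewrite {2}n0.
exists (x i 0); apply/colP => k; rewrite [RHS]mxE.
apply: (@laplacian_min_propagates _ _ i _ xi _ _ k).1 => //.
  by move=> j; rewrite lA mul0r.
by move=> j _; rewrite Qx mxE.
Qed.

(** A minimum c <= 0 would spread to all nodes, and a node with a positive loop then forces c =
    0. *)
Lemma strictly_loopy_pos (x : 'cV[R]_n) : strictly_loopy A ->
  (forall k, 0 <= (Q *m x) k 0) -> x = 0 \/ forall k, 0 < x k 0.
Proof.
move=> [l Al] Qx; have [n0|[i xi]] := cV_argmin x.
  by left; apply/colP => k; have := ltn_ord k; rewrite {2}n0.
have [x0|x0] := leP (x i 0) 0; last by right=> k; exact: lt_le_trans (xi k).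
left; have H : forall j, x j 0 = x i 0 /\ A j j * x i 0 = 0.
  apply: (@laplacian_min_propagates _ _ i) => // k.
  by rewrite mulr_ge0_le0.
have /eqP := (H l).2; rewrite mulf_eq0 gt_eqF //= => /eqP c0.
by apply/colP => k; rewrite (H k).1 c0 mxE.
Qed.

End Laplacian.

(** * Invertibility and positivity of the inverse *)

Lemma unitmx_ker0 (R : realType) n (M : 'M[R]_n) :
  (forall x : 'cV_n, M *m x = 0 -> x = 0) -> M \in unitmx.
Proof.
move=> H; rewrite -unitmx_tr -row_free_unit; apply: inj_row_free => v vM.
apply: trmx_inj; rewrite trmx0; apply: H.
by rewrite -[M]trmxK -trmx_mul vM trmx0.
Qed.

(** For a nonzero kernel vector, both [x] and [- x] would be entrywise positive. *)
Lemma strictly_loopy_unit (R : realType) n (A : 'M[R]_n) :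
  nonneg_mx A -> irreducible A -> strictly_loopy A ->
  loopy_laplacian A \in unitmx.
Proof.
move=> nA iA sA; apply: unitmx_ker0 => x Qx; have [l _] := sA.
have Q0 k : 0 <= (loopy_laplacian A *m x) k 0 by rewrite Qx mxE.
have QN0 k : 0 <= (loopy_laplacian A *m - x) k 0 by rewrite mulmxN Qx oppr0 mxE.
have [//|xp] := strictly_loopy_pos nA iA sA Q0.
have [/eqP|xn] := strictly_loopy_pos nA iA sA QN0.
  by rewrite oppr_eq0 => /eqP.
by have := xn l; rewrite mxE oppr_gt0 => /(lt_trans (xp l)); rewrite ltxx.
Qed.

(** Column [j] of the inverse is nonzero and is mapped to e_j >= 0. *)
Lemma strictly_loopy_inv_gt0 (R : realType) n (A : 'M[R]_n) i j :
  nonneg_mx A -> irreducible A -> strictly_loopy A ->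
  0 < invmx (loopy_laplacian A) i j.
Proof.
move=> nA iA sA; have uQ := strictly_loopy_unit nA iA sA.
set G := invmx _; have QG : loopy_laplacian A *m col j G = delta_mx j 0.
  by rewrite colE mulmxA mulmxV // mul1mx.
have QG0 k : 0 <= (loopy_laplacian A *m col j G) k 0.
  by rewrite QG mxE; case: (_ && _).
have [G0|H] := strictly_loopy_pos nA iA sA QG0; last first.
  by have := H i; rewrite mxE.
move: QG; rewrite G0 mulmx0 => /colP/(_ j)/eqP.
by rewrite !mxE !eqxx eq_sym oner_eq0.
Qed.

(** Extend a kernel vector [y] of the interior block by 0 on the boundary. A negative minimum lies
    in the interior, where [Q *m x] vanishes, and would spread to a boundary node, where [x] is 0.
    Hence y >= 0, and likewise for [- y]. *)
Lemma interior_unit (R : realType) p q (A : 'M[R]_(p + q)) :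
  (0 < p)%N -> nonneg_mx A -> irreducible A ->
  drsubmx (loopy_laplacian A) \in unitmx.
Proof.
move=> p0 nA iA; set Q := loopy_laplacian A.
have ge0 (y : 'cV[R]_q) : drsubmx Q *m y = 0 -> forall k, 0 <= y k 0.
  move=> Qy; pose x : 'cV[R]_(p + q) := col_mx 0 y.
  have [n0 k|[i xi]] := cV_argmin x.
    by have := ltn_ord (rshift p k); rewrite {2}n0.
  have [x0 k|x0 k] := leP 0 (x i 0).
    by have := xi (rshift p k); rewrite col_mxEd; exact: le_trans.
  have H : forall j, x j 0 = x i 0 /\ A j j * x i 0 = 0.
    apply: (@laplacian_min_propagates _ _ A nA iA _ _ i) => // [l|l xl].
      by rewrite mulr_ge0_le0 // ltW.
    move: xl; rewrite -[l]splitK; case: (fintype.split l) => {}l /=.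
      by rewrite col_mxEu mxE => xi0; rewrite -xi0 ltxx in x0.
    move=> _; rewrite -/Q -[Q]submxK mul_block_col col_mxEd.
    by rewrite mulmx0 add0r Qy mxE.
  have := (H (lshift q (Ordinal p0))).1; rewrite col_mxEu mxE => xi0.
  by rewrite -xi0 ltxx in x0.
apply: unitmx_ker0 => y Qy; apply/colP => k; rewrite [RHS]mxE.
apply/eqP; rewrite eq_le ge0 // andbT -oppr_ge0.
have : drsubmx Q *m - y = 0 by rewrite mulmxN Qy oppr0.
by move=> /ge0/(_ k); rewrite mxE.
Qed.

(** * Kron reduction as elimination of interior potentials *)

Section Kron.
Variables (R : realType) (p q : nat) (Q : 'M[R]_(p + q)).
Hypothesis uQ : drsubmx Q \in unitmx.

Lemma kron_solve m (X B : 'M[R]_(p, m)) (Y : 'M[R]_(q, m)) :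
  Q *m col_mx X Y = col_mx B 0 -> kron_reduction Q *m X = B.
Proof.
rewrite -{1}[Q]submxK mul_block_col => /eq_col_mx[<- e2].
have -> : Y = - (invmx (drsubmx Q) *m (dlsubmx Q *m X)).
  move/eqP: e2; rewrite addrC addr_eq0 => /eqP e2.
  by rewrite -mulmxN -e2 mulKmx.
by rewrite mulmxN /kron_reduction mulmxBl -!mulmxA.
Qed.

(** The witness is the harmonic extension of [X]: the interior potential solving the second block
    row with zero right-hand side. *)
Lemma kron_extend m (X : 'M[R]_(p, m)) : exists Y : 'M[R]_(q, m),
  Q *m col_mx X Y = col_mx (kron_reduction Q *m X) 0.
Proof.
exists (- (invmx (drsubmx Q) *m (dlsubmx Q *m X))).
rewrite -{1}[Q]submxK mul_block_col !mulmxN mulKVmx // subrr.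
by rewrite /kron_reduction mulmxBl -!mulmxA.
Qed.

End Kron.

(** * Effective resistance and the pseudoinverse *)

Lemma effective_resistanceE (R : realType) n (L : 'M[R]_n) i j :
  effective_resistance L i j =
  pinv L i i + pinv L j j - pinv L i j - pinv L j i.
Proof.
rewrite mxE /= [(_ - _)^T]raddfB /= !trmx_delta !mulmxBl !mulmxBr.
by rewrite -!rowE -!colE !mxE; ring.
Qed.

(** With d = L x, symmetry and the first Penrose equation turn d^T L^+ d into x^T L x = x^T d. Any
    solution [x] will do, so resistances can be found without computing the pseudoinverse. *)
Lemma effective_resistance_potential (R : realType) n (L : 'M[R]_n) i j
    (x : 'cV[R]_n) :
  L^T = L -> L *m x = delta_mx i 0 - delta_mx j 0 ->
  effective_resistance L i j = x i 0 - x j 0.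
Proof.
move=> sL Lx; rewrite mxE /= -Lx trmx_mul sL.
have [L1 _ _ _] := pinvP L.
rewrite -!mulmxA (mulmxA L) (mulmxA (L *m _)) L1 Lx mulmxBr -!colE.
by rewrite !mxE.
Qed.

(** The transpose satisfies the same Penrose equations, which have a unique solution. *)
Lemma pinv_sym (R : realType) n (L : 'M[R]_n) : L^T = L -> (pinv L)^T = pinv L.
Proof.
move=> sL; have [L1 L2 L3 L4] := pinvP L.
apply: (@is_pinv_uniq _ _ _ L); last exact: pinvP.
have e1 : L *m (pinv L)^T = pinv L *m L by rewrite -{1}sL -trmx_mul.
have e2 : (pinv L)^T *m L = L *m pinv L by rewrite -{2}sL -trmx_mul.
split; [| |by rewrite e1|by rewrite e2].
- by have := congr1 trmx L1; rewrite !trmx_mul sL mulmxA.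
- by have := congr1 trmx L2; rewrite !trmx_mul sL mulmxA.
Qed.

(** The defect [D] lies in the kernel of [Q], so its columns are constant; they also sum to zero, so
    they vanish. *)
Lemma pinv_range (R : realType) n (A : 'M[R]_n) m (B : 'M[R]_(n, m)) :
  symmetric_mx A -> nonneg_mx A -> irreducible A -> loopless A ->
  const_mx 1 *m B = 0 :> 'rV_m ->
  loopy_laplacian A *m (pinv (loopy_laplacian A) *m B) = B.
Proof.
move=> symA nA iA lA B0; set Q := loopy_laplacian A.
have sQ : Q^T = Q := loopy_laplacian_sym symA.
have [Q1 _ Q3 _] := pinvP Q.
have QQX : Q *m (Q *m pinv Q) = Q.
  by rewrite -{1}sQ -Q3 -trmx_mul Q1 sQ.
have oneQ : const_mx 1 *m Q = 0 :> 'rV_n.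
  apply: trmx_inj; rewrite trmx_mul sQ trmx_const loopy_laplacian_rowsum.
  by apply/colP => k; rewrite !mxE lA.
apply/eqP; rewrite -subr_eq0; apply/eqP; set D := _ - _.
have QD : Q *m D = 0 by rewrite mulmxBr !mulmxA -(mulmxA Q Q) QQX subrr.
have oneD : const_mx 1 *m D = 0 :> 'rV_m.
  by rewrite mulmxBr B0 !mulmxA oneQ !mul0mx subrr.
apply/matrixP => k j; rewrite [RHS]mxE.
have [c Dc] : exists c, col j D = const_mx c.
  apply: (@loopless_kernel_constant _ _ A) => //.
  by rewrite -/Q colE mulmxA QD mul0mx.
have DE l : D l j = c by have /colP/(_ l) := Dc; rewrite !mxE.
have /rowP/(_ j) := oneD; rewrite mxE [RHS]mxE.
under eq_bigr do rewrite [const_mx _ _ _]mxE mul1r DE.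
rewrite sumr_const card_ord => /eqP; rewrite mulrn_eq0.
case/orP => [/eqP n0|/eqP c0]; last by rewrite DE.
by have := ltn_ord k; rewrite {2}n0.
Qed.

(** * The algebra of matrices s I + t J *)

Definition uniform_mx (R : realType) p (s t : R) : 'M[R]_p :=
  s%:M + const_mx t.

Lemma uniform_mxE (R : realType) p (s t : R) (i j : 'I_p) :
  uniform_mx p s t i j = s *+ (i == j) + t.
Proof. by rewrite !mxE. Qed.

Lemma mul_const_mx (R : realType) m p n (s t : R) :
  (const_mx s : 'M_(m, p)) *m (const_mx t : 'M_(p, n)) =
  const_mx (p%:R * (s * t)).
Proof.
apply/matrixP => i j; rewrite !mxE; under eq_bigr do rewrite !mxE.
by rewrite sumr_const card_ord mulr_natl.
Qed.

Lemma mul_uniform_mx (R : realType) p (s t s' t' : R) :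
  uniform_mx p s t *m uniform_mx p s' t' =
  uniform_mx p (s * s') (s * t' + t * s' + p%:R * (t * t')).
Proof.
rewrite /uniform_mx mulmxDl !mulmxDr mul_const_mx -scalar_mxM.
rewrite mul_scalar_mx mul_mx_scalar -!addrA; congr (_ + _).
by apply/matrixP => i j; rewrite !mxE; ring.
Qed.

(** The two nonvanishing factors are the eigenvalues: s on the complement of the constants, and s +
    p t on the constants. *)
Lemma uniform_mx_inv (R : realType) p (s t : R) :
  s != 0 -> s + p%:R * t != 0 ->
  uniform_mx p s t *m uniform_mx p s^-1 (- (t / (s * (s + p%:R * t)))) = 1%:M.
Proof.
move=> s0 st0; rewrite mul_uniform_mx mulfV //.
rewrite (_ : _ + _ = 0) ?/uniform_mx; last by field; rewrite s0 st0.
by apply/matrixP => i j; rewrite !mxE addr0.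
Qed.

Lemma adjacency_uniform (R : realType) p (s t : R) (i j : 'I_p) :
  adjacency (uniform_mx p s t) i j =
  if i == j then s + p%:R * t else - t.
Proof.
rewrite mxE; case: eqVneq => [_|/negPf ij]; last first.
  by rewrite uniform_mxE ij add0r.
under eq_bigr do rewrite uniform_mxE.
rewrite big_split /= sumr_const card_ord mulr_natl; congr (_ + _).
by rewrite (bigD1 i) //= eqxx big1 ?addr0 // => k; rewrite eq_sym => /negPf ->.
Qed.

(** Off-diagonal entries are recovered first; the row sums then fix the diagonal. Hence reduced
    weights determine [kron_reduction Q]. *)
Lemma adjacency_inj (R : realType) p : injective (@adjacency R p).
Proof.
move=> M N /matrixP e.
have off i j : i != j -> M i j = N i j.
  by move=> ij; have := e i j; rewrite !mxE (negPf ij) => /oppr_inj.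
apply/matrixP => i j; have [<-|] := eqVneq i j; last exact: off.
have := e i i; rewrite !mxE eqxx (bigD1 i) //= [X in _ = X](bigD1 i) //=.
under eq_bigr => k ki do rewrite off 1?eq_sym //.
exact: addIr.
Qed.

Lemma uniform_adjacency (R : realType) p (M : 'M[R]_p) (a b : R) :
  (forall i j, i != j -> adjacency M i j = a) ->
  (forall i, adjacency M i i = b) ->
  M = uniform_mx p (p%:R * a + b) (- a).
Proof.
move=> Ma Mb; apply: adjacency_inj; apply/matrixP => i j.
rewrite adjacency_uniform opprK; case: eqVneq => [->|]; last exact: Ma.
by rewrite Mb; ring.
Qed.

(** * The loop-less case *)

Section Loopless.
Variables (R : realType) (p q : nat) (A : 'M[R]_(p + q)).
Hypotheses (p0 : (0 < p)%N).
Hypotheses (symA : symmetric_mx A) (nnegA : nonneg_mx A) (irrA : irreducible A).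
Hypothesis lA : loopless A.
Let Q := loopy_laplacian A.
Let K := kron_reduction Q.
Let uQ : drsubmx Q \in unitmx := interior_unit p0 nnegA irrA.

(** The all-ones vector lies in the kernel of [Q], and its boundary part is again all ones. *)
Lemma kron_loopless_rowsum : K *m const_mx 1 = 0 :> 'cV_p.
Proof.
apply: (kron_solve uQ (Y := const_mx 1)).
rewrite col_mx_const loopy_laplacian_rowsum col_mx0.
by apply/colP => k; rewrite !mxE lA.
Qed.

Lemma kron_loopless_loop i : adjacency K i i = 0.
Proof.
have /colP/(_ i) := kron_loopless_rowsum.
rewrite mxE [RHS]mxE [adjacency _ _ _]mxE eqxx => K0.
by rewrite -[RHS]K0; apply: eq_bigr => k _; rewrite [const_mx _ _ _]mxE mulr1.
Qed.

Lemma resistance_of_uniform_weight a : 0 < a ->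
  (forall i j, i != j -> adjacency K i j = a) ->
  forall i j : 'I_p, i != j ->
    effective_resistance Q (lshift q i) (lshift q j) = 2 / (p%:R * a).
Proof.
move=> a0 Ka i j ij.
have KE : K = uniform_mx p (p%:R * a) (- a).
  by rewrite (uniform_adjacency Ka kron_loopless_loop) addr0.
have pa0 : p%:R * a != 0 by rewrite mulf_neq0 ?gt_eqF ?ltr0n.
(* [K] acts as the scalar p a on zero-sum vectors, so dividing the current by p a gives the boundary
   potential. *)
pose y : 'cV[R]_p := (p%:R * a)^-1 *: (delta_mx i 0 - delta_mx j 0).
have Ky : K *m y = delta_mx i 0 - delta_mx j 0.
  rewrite -scalemxAr KE mulmxDl mul_scalar_mx mulmxBr -!colE.
  by rewrite !col_const subrr addr0 scalerA mulVf // scale1r.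
have [z Qz] := kron_extend uQ y.
rewrite (effective_resistance_potential (x := col_mx y z)).
- rewrite !col_mxEu !mxE !eqxx [j == i]eq_sym (negPf ij) /=; field.
  by move: pa0; rewrite mulf_eq0 negb_or andbC.
- exact: loopy_laplacian_sym.
rewrite Qz Ky; apply/colP => k; rewrite -[k]splitK.
case: (fintype.split k) => {}k /=.
  by rewrite col_mxEu !mxE !(inj_eq (@lshift_inj _ _)).
by rewrite col_mxEd !mxE !eq_rlshift subrr.
Qed.

(** The boundary block [Y] of the pseudoinverse inverts [K] on zero-sum vectors: K Y D = D with D =
    I - J/p. Constant resistances let [Y] be replaced there by r/2, so (r/2) K = D. *)
Lemma weight_of_uniform_resistance r : 0 < r ->
  (forall i j : 'I_p, i != j ->
    effective_resistance Q (lshift q i) (lshift q j) = r) ->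
  K = uniform_mx p (2 / r) (- (2 / r / p%:R)).
Proof.
move=> r0 Rr; have pr0 : p%:R != 0 :> R by rewrite gt_eqF ?ltr0n.
pose X := pinv Q; pose Y := ulsubmx X; pose D := uniform_mx p 1 (- p%:R^-1 : R).
have sX : X^T = X by apply: pinv_sym; exact: loopy_laplacian_sym.
have KJ t : K *m const_mx t = 0 :> 'M_p.
  have -> : const_mx t = (const_mx 1 : 'cV_p) *m (const_mx t : 'rV_p).
    by rewrite (mul_const_mx p 1 p) !mul1r.
  by rewrite mulmxA kron_loopless_rowsum mul0mx.
have oneD : const_mx 1 *m D = 0 :> 'rV_p.
  rewrite mulmxDr mul_mx_scalar mul_const_mx scale1r.
  by apply/rowP => k; rewrite !mxE mul1r mulrN mulfV // subrr.
(* The columns of [D] sum to zero, so, padded by zero interior currents, they lie in the range of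
   [Q]. *)
have KYD : K *m (Y *m D) = D.
  apply: (kron_solve uQ (Y := dlsubmx X *m D)).
  have -> : col_mx (Y *m D) (dlsubmx X *m D) = X *m col_mx D 0.
    by rewrite -{2}[X]submxK mul_block_col !mulmx0 !addr0.
  apply: pinv_range => //.
  by rewrite -(row_mx_const _ p q) mul_row_col mulmx0 addr0 oneD.
(* Polarization: constant resistances make [Y] equal to (r/2) I up to terms
   that vanish between [K] and [D], the projector orthogonal to constants. *)
pose u : 'cV[R]_p := \col_k (Y k k / 2 - r / 4).
have YE : Y = (r / 2)%:M + (u *m const_mx 1 + const_mx 1 *m u^T).
  apply/matrixP => i j; rewrite [RHS]mxE [X in _ + X]mxE.
  rewrite [in X in _ + X]mxE big_ord1 [X in _ + (_ + X)]mxE big_ord1.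
  have [<-|ij] := eqVneq i j; first by rewrite !mxE eqxx mulr1n; field.
  have := Rr i j ij; rewrite effective_resistanceE -/X.
  have -> : X (lshift q j) (lshift q i) = X (lshift q i) (lshift q j).
    by rewrite -{1}sX mxE.
  by rewrite !mxE (negPf ij) mulr0n; lra.
have KD : K *m D = K by rewrite mulmxDr mulmx1 KJ addr0.
have YD : Y *m D = (r / 2) *: D + const_mx 1 *m (u^T *m D).
  by rewrite YE !mulmxDl -!(mulmxA _ _ D) oneD mulmx0 add0r mul_scalar_mx.
have KE : (r / 2) *: K = D.
  rewrite -[RHS]KYD YD [RHS]mulmxDr (mulmxA K) kron_loopless_rowsum.
  by rewrite mul0mx addr0 -scalemxAr KD.
have -> : K = (2 / r) *: D.
  rewrite -KE scalerA (_ : _ * _ = 1) ?scale1r //; field; exact: lt0r_neq0.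
by apply/matrixP => i j; rewrite !mxE; ring.
Qed.

End Loopless.

(** * Potentials of the grounded network *)

Section Augmented.
Variables (R : realType) (n : nat) (A : 'M[R]_n).
Hypotheses (symA : symmetric_mx A) (nnegA : nonneg_mx A) (irrA : irreducible A).
Hypothesis sA : strictly_loopy A.
Let Q := loopy_laplacian A.
Let G := invmx Q.

Lemma augmented_laplacian_sym :
  (augmented_laplacian A)^T = augmented_laplacian A.
Proof.
rewrite /augmented_laplacian tr_block_mx loopy_laplacian_sym // tr_scalar_mx.
by rewrite !raddfN /= trmxK.
Qed.

Lemma augmented_laplacian_solve m (B : 'M[R]_(n, m)) :
  augmented_laplacian A *m col_mx (G *m B) 0 =
  col_mx B (- (const_mx 1 *m B)).
Proof.
have u := strictly_loopy_unit nnegA irrA sA.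
(* The loop vector is a = Q 1, so a^T G B = 1^T Q G B = 1^T B: the ground absorbs the net
   current. *)
have aGB : (- (\col_i A i i)^T) *m (G *m B) = - (const_mx 1 *m B) :> 'M_(1, m).
  rewrite -loopy_laplacian_rowsum trmx_mul loopy_laplacian_sym // trmx_const.
  by rewrite mulNmx -mulmxA mulKVmx.
by rewrite mul_block_col !mulmx0 !addr0 mulKVmx // aGB.
Qed.

Lemma loopy_inv_sym i j : G j i = G i j.
Proof. by rewrite -[G in LHS]trmxK mxE /G trmx_inv loopy_laplacian_sym. Qed.

Lemma const_mx_mul_delta (i : 'I_n) :
  const_mx 1 *m (delta_mx i 0 : 'cV[R]_n) = 1%:M :> 'M_1.
Proof.
by rewrite -colE col_const; apply/matrixP => k l; rewrite !mxE !ord1.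
Qed.

Lemma delta_lshift (i : 'I_n) :
  delta_mx (lshift 1 i) 0 = col_mx (delta_mx i 0) 0 :> 'cV[R]_(n + 1).
Proof.
apply/colP => k; rewrite -[k]splitK; case: (fintype.split k) => {}k /=.
  by rewrite col_mxEu !mxE (inj_eq (@lshift_inj _ _)).
by rewrite col_mxEd !mxE eq_rlshift.
Qed.

Lemma delta_rshift :
  delta_mx (rshift n ord0) 0 = col_mx 0 1%:M :> 'cV[R]_(n + 1).
Proof.
apply/colP => k; rewrite -[k]splitK; case: (fintype.split k) => {}k /=.
  by rewrite col_mxEu !mxE eq_lrshift.
by rewrite col_mxEd !mxE (inj_eq (@rshift_inj _ _)) !ord1.
Qed.

Lemma augmented_resistance i j :
  effective_resistance (augmented_laplacian A) (lshift 1 i) (lshift 1 j) =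
  G i i + G j j - 2 * G i j.
Proof.
pose d : 'cV[R]_n := delta_mx i 0 - delta_mx j 0.
rewrite (effective_resistance_potential (x := col_mx (G *m d) 0)).
- by rewrite !col_mxEu mulmxBr -!colE !mxE -/G (loopy_inv_sym i j); ring.
- exact: augmented_laplacian_sym.
rewrite augmented_laplacian_solve !delta_lshift opp_col_mx add_col_mx.
by rewrite mulmxBr !const_mx_mul_delta !subrr oppr0.
Qed.

Lemma augmented_ground_resistance i :
  effective_resistance (augmented_laplacian A) (lshift 1 i) (rshift n ord0) =
  G i i.
Proof.
rewrite (effective_resistance_potential (x := col_mx (G *m delta_mx i 0) 0)).
- by rewrite col_mxEu col_mxEd -colE !mxE subr0.
- exact: augmented_laplacian_sym.
rewrite augmented_laplacian_solve delta_lshift delta_rshift opp_col_mx.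
by rewrite add_col_mx const_mx_mul_delta oppr0 addr0 add0r.
Qed.

End Augmented.

(** * The strictly loopy case *)

Section StrictlyLoopy.
Variables (R : realType) (p q : nat) (A : 'M[R]_(p + q)).
Hypotheses (p0 : (0 < p)%N).
Hypotheses (symA : symmetric_mx A) (nnegA : nonneg_mx A) (irrA : irreducible A).
Hypothesis sA : strictly_loopy A.
Let Q := loopy_laplacian A.
Let K := kron_reduction Q.
Let G := invmx Q.
Let uQ : drsubmx Q \in unitmx := interior_unit p0 nnegA irrA.
Let Rs := effective_resistance (augmented_laplacian A).
Let bd (i : 'I_p) : 'I_(p + q + 1) := lshift 1 (lshift q i).
Let ground : 'I_(p + q + 1) := rshift (p + q) ord0.

(** The first p columns of Q G = I are systems with no interior current, to which elimination
    applies. *)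
Lemma kron_inverse : K *m ulsubmx G = 1%:M.
Proof.
apply: (kron_solve uQ (Y := dlsubmx G)).
have := mulmxV (strictly_loopy_unit nnegA irrA sA); rewrite -/Q -/G.
rewrite -{1}[G]submxK block_mxEh mul_mx_row (scalar_mx_block _ _ 1) block_mxEh.
by move=> /eq_row_mx[].
Qed.

Lemma inverse_of_uniform_resistance r g :
  (forall i j, i != j -> Rs (bd i) (bd j) = r) ->
  (forall i, Rs (bd i) ground = g) ->
  ulsubmx G = uniform_mx p (r / 2) (g - r / 2).
Proof.
move=> Rr Rg; apply/matrixP => i j; rewrite uniform_mxE.
have Gd k : ulsubmx G k k = g.
  by rewrite -(Rg k) /Rs augmented_ground_resistance // !mxE.
have [<-|ij] := eqVneq i j; first by rewrite Gd mulr1n; ring.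
have := Rr i j ij; rewrite /Rs augmented_resistance // -/G.
have := Gd i; have := Gd j; rewrite !mxE mulr0n => -> ->; lra.
Qed.

Lemma weight_of_uniform_loopy_resistance r g (c := g - r / 2) :
  (1 < p)%N -> 0 < r ->
  (forall i j, i != j -> Rs (bd i) (bd j) = r) ->
  (forall i, Rs (bd i) ground = g) ->
  0 < c /\ K = uniform_mx p (r / 2)^-1 (- (c / (r / 2 * (r / 2 + p%:R * c)))).
Proof.
move=> p1 r0 Rr Rg; have HE := inverse_of_uniform_resistance Rr Rg.
(* [c] is an off-diagonal entry of the boundary block of [G], available since p >= 2; every entry of
   [G] is positive. *)
have c0 : 0 < c.
  have := @strictly_loopy_inv_gt0 _ _ A (lshift q (Ordinal p0))
    (lshift q (Ordinal p1)) nnegA irrA sA.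
  have /matrixP/(_ (Ordinal p0) (Ordinal p1)) := HE.
  by rewrite uniform_mxE !mxE add0r => ->.
have r2 : 0 < r / 2 by rewrite divr_gt0.
split=> //; have := @uniform_mx_inv R p (r / 2) c.
rewrite !gt_eqF //; last by rewrite addr_gt0 // mulr_gt0 ?ltr0n.
move=> /(_ isT isT) HU; rewrite -[K]mulmx1 -HU -HE mulmxA kron_inverse.
by rewrite mul1mx.
Qed.

Lemma inverse_of_uniform_weight a b : 0 < a -> 0 <= b ->
  (forall i j, i != j -> adjacency K i j = a) ->
  (forall i, adjacency K i i = b) ->
  0 < b /\
  ulsubmx G = uniform_mx p (p%:R * a + b)^-1 (a / (b * (p%:R * a + b))).
Proof.
move=> a0 b0 Ka Kb; have KE := uniform_adjacency Ka Kb.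
have bn0 : b != 0.
  (* If b = 0, all row sums of [K] vanish, so [K] kills the constants although it is invertible. *)
  apply/eqP => bz; have : K *m const_mx 1 = 0 :> 'cV_p.
    rewrite KE mulmxDl mul_scalar_mx mul_const_mx bz.
    by apply/colP => k; rewrite !mxE; ring.
  move=> /(congr1 (mulmx (ulsubmx G))); rewrite mulmxA mulmx0.
  rewrite (mulmx1C kron_inverse) mul1mx => /colP/(_ (Ordinal p0))/eqP.
  by rewrite !mxE oner_eq0.
have bp : 0 < b by rewrite lt_def bn0.
have pab : 0 < p%:R * a + b by rewrite addr_gt0 // mulr_gt0 ?ltr0n.
split=> //; have := @uniform_mx_inv R p (p%:R * a + b) (- a).
have -> : p%:R * a + b + p%:R * - a = b by ring.
move=> /(_ (lt0r_neq0 pab) bn0); rewrite -KE => KU.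
rewrite -[LHS]mulmx1 -KU mulmxA (mulmx1C kron_inverse) mul1mx.
by congr uniform_mx; rewrite mulNr opprK (mulrC b).
Qed.

Lemma loopy_resistance_of_uniform_weight a b : 0 < a -> 0 <= b ->
  (forall i j, i != j -> adjacency K i j = a) ->
  (forall i, adjacency K i i = b) ->
  [/\ 0 < b,
      forall i j, i != j -> Rs (bd i) (bd j) = 2 / (p%:R * a + b) &
      forall i, Rs (bd i) ground = (a + b) / (b * (a * p%:R + b))].
Proof.
move=> a0 b0 Ka Kb; have [bp HE] := inverse_of_uniform_weight a0 b0 Ka Kb.
have pab : p%:R * a + b != 0.
  by rewrite gt_eqF // addr_gt0 // mulr_gt0 ?ltr0n.
have GE i j : G (lshift q i) (lshift q j) =
    (p%:R * a + b)^-1 *+ (i == j) + a / (b * (p%:R * a + b)).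
  by have /matrixP/(_ i j) := HE; rewrite uniform_mxE !mxE.
split=> // [i j ij|i].
  rewrite /Rs augmented_resistance // -/G !GE !eqxx (negPf ij) /=.
  by rewrite !mulr1n mulr0n; field; rewrite pab gt_eqF.
rewrite /Rs augmented_ground_resistance // -/G GE eqxx (mulrC a p%:R) /= mulr1n.
by field; rewrite pab gt_eqF.
Qed.

End StrictlyLoopy.

(** * Assembly of both equivalences and their formulas *)

Theorem mainTheorem3 (R : realType) (p q : nat) (A : 'M[R]_(p + q))
    (hp : (2 <= p)%N) (hq : (0 < q)%N)
    (symA : symmetric_mx A) (nnegA : nonneg_mx A) (irrA : irreducible A) :
  let Q := loopy_laplacian A in
  let Ared := adjacency (kron_reduction Q) in
  (loopless A ->
    let Rs := effective_resistance Q in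
    let uniform_resistance (r : R) :=
      forall i j : 'I_p, i != j -> Rs (lshift q i) (lshift q j) = r in
    let uniform_weight (a : R) :=
      forall i j : 'I_p, i != j -> Ared i j = a in
    ((exists2 r : R, 0 < r & uniform_resistance r) <->
     (exists2 a : R, 0 < a & uniform_weight a)) /\
    (forall r a : R, 0 < r -> uniform_resistance r ->
       0 < a -> uniform_weight a ->
       r = 2 / (p%:R * a)))
  /\
  (strictly_loopy A ->
    let Rs := effective_resistance (augmented_laplacian A) in
    let bd (i : 'I_p) : 'I_(p + q + 1) := lshift 1 (lshift q i) in
    let ground : 'I_(p + q + 1) := rshift (p + q) ord0 in
    let uniform_resistance (r : R) :=
      forall i j : 'I_p, i != j -> Rs (bd i) (bd j) = r in
    let uniform_ground_resistance (g : R) :=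
      forall i : 'I_p, Rs (bd i) ground = g in
    let uniform_weight (a : R) :=
      forall i j : 'I_p, i != j -> Ared i j = a in
    let uniform_loop (b : R) :=
      forall i : 'I_p, Ared i i = b in
    (((exists2 r : R, 0 < r & uniform_resistance r) /\
      (exists2 g : R, 0 < g & uniform_ground_resistance g)) <->
     (exists a b : R,
       [/\ 0 < a, 0 <= b, uniform_weight a & uniform_loop b])) /\
    (forall r g a b : R,
       0 < r -> uniform_resistance r ->
       0 < g -> uniform_ground_resistance g ->
       0 < a -> 0 <= b -> uniform_weight a -> uniform_loop b ->
       r = 2 / (p%:R * a + b) /\
       g = (a + b) / (b * (a * p%:R + b)))).
Proof.
have p0 : (0 < p)%N := ltnW hp.
have pR : 0 < p%:R :> R by rewrite ltr0n.
(* Two distinct boundary nodes make the uniformity conditions nonvacuous, so each constant can be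
   read off an actual entry. *)
have ne01 : Ordinal p0 != Ordinal hp by [].
move=> Q Ared; split=> [lA|sA].
  move=> Rs ur uw; split; last first.
    move=> r a r0 hr a0 ha.
    have := resistance_of_uniform_weight p0 symA nnegA irrA lA a0 ha ne01.
    by rewrite (hr _ _ ne01).
  split=> [[r r0 hr]|[a a0 ha]].
    exists (2 / r / p%:R); first by rewrite !divr_gt0.
    move=> i j ij; rewrite /Ared.
    rewrite (weight_of_uniform_resistance p0 symA nnegA irrA lA r0 hr).
    by rewrite adjacency_uniform (negPf ij) opprK.
  exists (2 / (p%:R * a)); first by rewrite divr_gt0 // mulr_gt0.
  exact: resistance_of_uniform_weight.
move=> Rs bd ground ur ug uw ul; split; last first.
  move=> r g a b r0 hr g0 hg a0 b0 ha hb.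
  have [_ Hr Hg] :=
    loopy_resistance_of_uniform_weight p0 symA nnegA irrA sA a0 b0 ha hb.
  split; first by rewrite -(Hr _ _ ne01) -(hr _ _ ne01).
  by rewrite -(Hg (Ordinal p0)) -(hg (Ordinal p0)).
split=> [[[r r0 hr] [g g0 hg]]|[a [b [a0 b0 ha hb]]]].
  have [] :=
    weight_of_uniform_loopy_resistance p0 symA nnegA irrA sA hp r0 hr hg.
  set c := g - r / 2 => c0 KE.
  have r2 : 0 < r / 2 by rewrite divr_gt0.
  have rc : 0 < r / 2 + p%:R * c by rewrite addr_gt0 // mulr_gt0.
  (* Here a is minus the off-diagonal entry of [K]. The loop weight b is the row sum of [K], the
     inverse of the row sum r/2 + p c of the boundary block of the inverse Laplacian. *)
  exists (c / (r / 2 * (r / 2 + p%:R * c))), (r / 2 + p%:R * c)^-1; split.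
  - by rewrite divr_gt0 // mulr_gt0.
  - by rewrite invr_ge0 ltW.
  - move=> i j ij; rewrite /Ared KE adjacency_uniform (negPf ij); exact: opprK.
  - move=> i; rewrite /Ared KE adjacency_uniform eqxx.
    move: (lt0r_neq0 r2) (lt0r_neq0 rc); move: (r / 2) => s s0 sc.
    by field; rewrite s0 sc.
have [bp Hr Hg] :=
  loopy_resistance_of_uniform_weight p0 symA nnegA irrA sA a0 b0 ha hb.
split; [exists (2 / (p%:R * a + b)) => //|
  exists ((a + b) / (b * (a * p%:R + b))) => //].
  by rewrite divr_gt0 // addr_gt0 // mulr_gt0.
by rewrite divr_gt0 ?addr_gt0 // mulr_gt0 // addr_gt0 // mulr_gt0.
Qed.
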